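(* Let $G=(V,E)$ be a connected graph on $n$ vertices with adjacency matrix $A$ having eigenvalues $\lambda_1\ge\cdots\ge\lambda_n$, let $k\in\mathbb{N}^+$, and let $p\in\mathbb{R}_k[x]$ be a real polynomial of degree at most $k$ such that $p(\lambda_1)\ge \Lambda(p)$, where $\Lambda(p)=\max_{i\in\{2,\dots,n\}}p(\lambda_i)$. Let $W(p)=\max_{u\in V}p(A)_{uu}$ and let $\kappa(p)$ be the smallest integer $\kappa$ such that $$(\kappa+1)W(p)\ \ge\ p(\lambda_1)+\sum_{i=1}^{\kappa}\lambda_{n-i+1}(p(A)),$$ where $\lambda_1(p(A))\ge\cdots\ge\lambda_n(p(A))$ are the eigenvalues of $p(A)$. Then the distance-$k$ quantum chromatic number of $G$ satisfies $\chi_{kq}(G)\ge \kappa(p)+1$.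
   Context: $d_G(v,w)$ denotes graph distance. An orthogonal projector is a complex matrix $P$ with $P^2=P=P^{\dagger}$. A distance-$k$ quantum $c$-coloring of $G$ is, for some dimension $d>0$, a collection of orthogonal projectors $\{P_{v,i}\mid v\in V, i\in[c]\}$ in $\mathbb{C}^{d\times d}$ such that $\sum_{i\in[c]}P_{v,i}=I_d$ for every $v\in V$, and $P_{v,i}P_{w,i}=0$ for all distinct $v,w$ with $d_G(v,w)\le k$ and all $i\in[c]$. The distance-$k$ quantum chromatic number $\chi_{kq}(G)$ is the smallest $c$ for which such a coloring exists (equivalently, the quantum chromatic number of the $k$-th power graph $G^k$, whose edges join distinct vertices at distance at most $k$ in $G$). *)

(* Defs.v *)
From HB Require Import structures.
From mathcomp Require Import all_boot all_order all_algebra.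
From mathcomp Require Import polyrcf complex.
From mathcomp Require Import boolp reals constructive_ereal.
From mathcomp Require Import spectral.

Set Implicit Arguments.
Unset Strict Implicit.
Unset Printing Implicit Defensive.

Import Order.TTheory GRing.Theory Num.Theory.

Local Open Scope ring_scope.
Local Open Scope sesquilinear_scope.

(* A simple graph on V is a symmetric irreflexive relation e : rel V. *)

Definition connected_graph (V : finType) (e : rel V) : Prop :=
  (0 < #|V|)%N /\ forall v w : V, connect e v w.

(* Length of a shortest walk from v to w.  A shortest walk has fewer than #|V|
   edges, so the value is #|V| exactly when w is not reachable from v. *)
Definition gdist (V : finType) (e : rel V) (v w : V) : nat :=
  find (fun m => [exists s : m.-tuple V, path e v s && (last v s == w)])
       (iota 0 #|V|).

(* d_G(v, w) <= k; unreachable pairs are at infinite distance. *)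
Definition within_dist (V : finType) (e : rel V) (k : nat) (v w : V) : bool :=
  connect e v w && (gdist e v w <= k)%N.

Section QuantumColoring.
Variable R : realType.

Definition orth_projector (d : nat) (P : 'M[R[i]]_d) : Prop :=
  P *m P = P /\ P ^t* = P.

Definition quantum_coloring (V : finType) (e : rel V) (k c d : nat)
    (P : V -> 'I_c -> 'M[R[i]]_d) : Prop :=
  [/\ forall v i, orth_projector (P v i),
      forall v, \sum_(i < c) P v i = 1%:M
    & forall v w, v != w -> within_dist e k v w ->
        forall i, P v i *m P w i = 0].

Definition quantum_colorable (V : finType) (e : rel V) (k c : nat) : Prop :=
  exists2 d : nat, (0 < d)%N &
    exists P : V -> 'I_c -> 'M[R[i]]_d, quantum_coloring e k P.

Lemma quantum_colorable_ex (V : finType) (e : rel V) (k : nat) :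
  exists c, `[< quantum_colorable e k c >].
Proof.
exists #|V|; apply/asboolP; exists 1%N => //.
exists (fun v i => (i == enum_rank v)%:R%:M); split.
- move=> v i; split; first by case: eqP; rewrite -scalar_mxM ?mulr1 ?mulr0.
  by rewrite tr_scalar_mx map_scalar_mx /= rmorph_nat.
- move=> v; rewrite -[LHS](raddf_sum (@scalar_mx _ _)) /=.
  rewrite (bigD1 (enum_rank v)) //= eqxx big1 ?addr0 // => i /negbTE -> //.
- move=> v w vw _ i; rewrite -scalar_mxM -natrM mulnb.
  case: eqP => [->|_]; last by rewrite raddf0.
  by rewrite (inj_eq enum_rank_inj) (negbTE vw) raddf0.
Qed.

Definition quantum_chromatic (V : finType) (e : rel V) (k : nat) : nat :=
  ex_minn (quantum_colorable_ex e k).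

End QuantumColoring.

Section Spectrum.
Variable R : realType.

(* The real eigenvalues with algebraic multiplicity, in nonincreasing order;
   a symmetric matrix of order n has exactly n of them. *)
Definition eigenvalues (n : nat) (A : 'M[R]_n) : seq R :=
  sort >=%R (flatten [seq nseq (mup x (char_poly A)) x
                         | x <- rootsR (char_poly A)]).

(* The i-th largest eigenvalue, counting from i = 1. *)
Definition lambda (n : nat) (A : 'M[R]_n) (i : nat) : R :=
  (eigenvalues A)`_(i.-1).

(* [horner_mx] only accepts matrices whose order is syntactically a successor,
   which #|V| is not. *)
Definition mxpoly (n : nat) (p : {poly R}) (A : 'M[R]_n) : 'M[R]_n :=
  \sum_(i < size p) p`_i *: A ^+ i.

Lemma mxpolyE (n : nat) (p : {poly R}) (A : 'M[R]_n.+1) :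
  mxpoly p A = horner_mx A p.
Proof.
rewrite -[in RHS](coefK p) poly_def raddf_sum; apply: eq_bigr => i _.
by rewrite /= linearZ /= rmorphXn /= horner_mx_X.
Qed.

Variables (V : finType) (e : rel V).

Definition adjmx : 'M[R]_#|V| :=
  \matrix_(i, j) (e (enum_val i) (enum_val j))%:R.

(* max of p(lambda_i) over 2 <= i <= n, which is -oo when n = 1. *)
Definition Lambda (p : {poly R}) : \bar R :=
  \big[maxe/-oo%E]_(2 <= i < #|V|.+1) (p.[lambda adjmx i])%:E.

Definition W (p : {poly R}) : R :=
  fine (\big[maxe/-oo%E]_(u : 'I_#|V|) (mxpoly p adjmx u u)%:E).

Definition kappa_ineq (p : {poly R}) (j : nat) : bool :=
  p.[lambda adjmx 1]
    + \sum_(1 <= i < j.+1) lambda (mxpoly p adjmx) (#|V| - i + 1)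
  <= j.+1%:R * W p.

(* The least j satisfying the inequality.  When e is symmetric, V is nonempty
   and Lambda p <= p(lambda_1), the index j = #|V| - 1 always does: the left
   side is then the trace of p(A), which is at most #|V| * W p. *)
Definition kappa (p : {poly R}) : nat :=
  find (kappa_ineq p) (iota 0 #|V|).

End Spectrum.

(* Main.v *)
(** Let [B = p(A)] and let [z] be an eigenvector of [A] for [lambda_1].  On
    [C^n (x) C^d] the matrices [P_i = \sum_v e_v e_v^* (x) P_{v,i}] are
    projectors summing to the identity, and the pinching
    [\sum_i P_i (B (x) 1) P_i] equals [diag(B) (x) 1], because an off-diagonal
    entry [B_vw] vanishes unless [v] and [w] are within distance [k].  Let [Q]
    be the orthogonal projector onto the sum of the spaces [P_i (z (x) C^d)].
    It commutes with every [P_i], fixes [z (x) C^d] and has rank at most [c d];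
    hence [\tr (Q (B (x) 1)) <= W \tr Q].  Expanding the left side in an
    eigenbasis [z_j] of [A] gives weights [\tr (Q (z_j z_j^* (x) 1)) / d] in
    [[0, 1]], equal to 1 on [z] and of sum at most [c].  A convex combination
    with the constant weight 1 brings the sum to exactly [c], and a weighted sum
    of eigenvalues whose weights in [[0, 1]] add up to [m] is at least the sum
    of the [m] smallest ones. *)
Require Import Defs.
From mathcomp Require Import all_boot all_order all_algebra.
From mathcomp Require Import polyrcf complex mxtens spectral.
From mathcomp Require Import boolp reals constructive_ereal.
From mathcomp Require Import ring lra.

Set Implicit Arguments.
Unset Strict Implicit.
Unset Printing Implicit Defensive.

Import Order.TTheory GRing.Theory Num.Theory.

Local Open Scope ring_scope.
Local Open Scope sesquilinear_scope.

(** * Adjoints, traces and orthogonal projectors *)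

Section ConjugateTranspose.
Variable C : numClosedFieldType.

Lemma trCmx_mul m n p (A : 'M[C]_(m, n)) (B : 'M[C]_(n, p)) :
  (A *m B)^t* = B^t* *m A^t*.
Proof. by rewrite trmx_mul map_mxM. Qed.

Lemma trCmx_tens m n p q (A : 'M[C]_(m, n)) (B : 'M[C]_(p, q)) :
  (A *t B)^t* = A^t* *t B^t*.
Proof. by rewrite trmx_tens map_mxT. Qed.

Lemma mxtrace_gramE m n (M : 'M[C]_(m, n)) :
  \tr (M *m M^t*) = \sum_i \sum_j `|M i j| ^+ 2.
Proof.
by apply: eq_bigr => i _; rewrite mxE; apply: eq_bigr => j _; rewrite !mxE normCK.
Qed.

Lemma mxtrace_gram_ge0 m n (M : 'M[C]_(m, n)) : 0 <= \tr (M *m M^t*).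
Proof.
by rewrite mxtrace_gramE !sumr_ge0 // => i _; rewrite sumr_ge0 // => j _; exact: exprn_ge0.
Qed.

Lemma mxtrace_gram_eq0 m n (M : 'M[C]_(m, n)) : \tr (M *m M^t*) = 0 -> M = 0.
Proof.
rewrite mxtrace_gramE => M0; apply/matrixP => i j; rewrite mxE.
have ge0 i' j' : 0 <= `|M i' j'| ^+ 2 by exact: exprn_ge0.
have Mi := psumr_eq0P (fun k _ => sumr_ge0 _ (fun l _ => ge0 k l)) M0.
have Mij := psumr_eq0P (fun l _ => ge0 i l) (Mi i isT).
have /eqP := Mij j isT.
by rewrite expf_eq0 /= normr_eq0 => /eqP.
Qed.

Definition mxprojector n (P : 'M[C]_n) := P *m P = P /\ P^t* = P.

Lemma mxtrace_projector_ge0 m n (Y : 'M[C]_(m, n)) (Q : 'M[C]_n) :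
  mxprojector Q -> 0 <= \tr (Q *m (Y^t* *m Y)).
Proof.
case=> QQ Qh; rewrite mulmxA mxtrace_mulC.
have -> : Y *m (Q *m Y^t*) = (Y *m Q) *m (Y *m Q)^t*.
  by rewrite trCmx_mul Qh -!mulmxA (mulmxA Q) QQ.
exact: mxtrace_gram_ge0.
Qed.

Lemma mxprojector_compl n (Q : 'M[C]_n) : mxprojector Q -> mxprojector (1%:M - Q).
Proof.
case=> QQ Qh; split; first by rewrite mulmxBl mul1mx mulmxBr mulmx1 QQ subrr subr0.
by rewrite linearB /= map_mxB trmx1 map_mx1 Qh.
Qed.

(** Multiplying [\sum_k P k = 1%:M] by [P i] on both sides shows that the terms [P i *m P k *m P i]
    with [k != i] sum to 0. Each is the Gram matrix of [P i *m P k], so its trace is nonnegative and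
    every term vanishes. *)
Lemma projectors_sum1_ortho n (I : finType) (P : I -> 'M[C]_n) :
  (forall i, mxprojector (P i)) -> \sum_i P i = 1%:M ->
  forall i j, i != j -> P i *m P j = 0.
Proof.
move=> Pp P1 i j ij; have [Pi Pih] := Pp i.
have E : \sum_(k | k != i) P i *m P k *m P i = 0.
  apply: (addrI (P i *m P i *m P i)); rewrite -(bigD1 i (P := xpredT)) //=.
  by rewrite -mulmx_suml -mulmx_sumr P1 mulmx1 addr0 !Pi.
apply: mxtrace_gram_eq0.
have {}E : \sum_(k | k != i) \tr ((P i *m P k) *m (P i *m P k)^t*) = 0.
  rewrite -[RHS](mxtrace0 C n) -E raddf_sum; apply: eq_bigr => k _.
  by have [Pk Pkh] := Pp k; rewrite trCmx_mul Pih Pkh mulmxA -(mulmxA (P i)) Pk.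
apply: psumr_eq0P E _ _; last by rewrite eq_sym.
by move=> k _; exact: mxtrace_gram_ge0.
Qed.

(** Vectors are rows here. Orthonormalizing a row basis of [M] gives [S] with [S *m S^t* = 1%:M],
    and [S^t* *m S] is the projector. *)
Lemma rowspace_projector m n (M : 'M[C]_(m, n)) :
  exists Q : 'M[C]_n, [/\ mxprojector Q, (Q <= M)%MS, M *m Q = M
                        & \tr Q = (\rank M)%:R].
Proof.
pose S := schmidt (row_base M).
have S1 : S *m S^t* = 1%:M by apply/unitarymxP/schmidt_unitarymx/rank_leq_col.
have SM : (S :=: M)%MS.
  exact: eqmx_trans (eqmx_schmidt_free (row_base_free M)) (eq_row_base M).
exists (S^t* *m S); split; first split.
- by rewrite mulmxA -(mulmxA _ S) S1 mulmx1.
- by rewrite trCmx_mul trmxCK.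
- by rewrite -SM submxMl.
- have /submxP[X MX] : (M <= S)%MS by rewrite SM.
  by rewrite mulmxA [M *m _](congr1 (mulmx^~ _) MX) -(mulmxA X) S1 mulmx1 -MX.
- by rewrite mxtrace_mulC S1 mxtrace1.
Qed.

Lemma mxprojector_sum n (I : finType) (Q : I -> 'M[C]_n) :
  (forall i, mxprojector (Q i)) -> (forall i j, i != j -> Q i *m Q j = 0) ->
  mxprojector (\sum_i Q i).
Proof.
move=> Qp Qo; split; last first.
  by rewrite 2!raddf_sum; apply: eq_bigr => i _; have [] := Qp i.
rewrite mulmx_suml; apply: eq_bigr => i _.
rewrite mulmx_sumr (bigD1 i) //= big1 ?addr0 => [|j ji]; first by have [] := Qp i.
by rewrite Qo // eq_sym.
Qed.

(** [Q] is the sum of the projectors onto the row spaces of the [Z *m P i]. These lie in the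
    mutually orthogonal ranges of the [P i], whence the commutation; each has rank at most [m], the
    number of rows of [Z]. *)
Lemma block_projector n m (I : finType) (P : I -> 'M[C]_n) (Z : 'M[C]_(m, n)) :
    (forall i, mxprojector (P i)) -> \sum_i P i = 1%:M ->
  exists Q : 'M[C]_n, [/\ mxprojector Q, forall i, Q *m P i = P i *m Q,
    Z *m Q = Z & \tr Q <= (#|I| * m)%:R].
Proof.
move=> Pp P1; have Po := projectors_sum1_ortho Pp P1.
have [Q HQ] := choice (fun i => rowspace_projector (Z *m P i)).
have Qp i : mxprojector (Q i) by have [] := HQ i.
have QP i : Q i *m P i = Q i.
  have [_ /submxP[X ->] _ _] := HQ i; have [PP _] := Pp i.
  by rewrite -!mulmxA PP.
have QP0 i j : i != j -> Q i *m P j = 0.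
  by move=> ij; rewrite -QP -mulmxA Po // mulmx0.
(* Taking adjoints carries [QP] and [QP0] over to products with [P j] on the left. *)
have PQ i j : P j *m Q i = if i == j then Q i else 0.
  have [_ Qh] := Qp i; have [_ Ph] := Pp j; rewrite -Qh -Ph -trCmx_mul.
  case: eqP => [->|/eqP ij]; first by rewrite QP.
  by rewrite QP0 // trmx0 map_mx0.
have QQ0 i j : i != j -> Q i *m Q j = 0.
  by move=> ij; rewrite -QP -mulmxA PQ eq_sym (negbTE ij) mulmx0.
exists (\sum_i Q i); split.
- exact: mxprojector_sum.
- move=> i; rewrite mulmx_suml mulmx_sumr; apply: eq_bigr => j _; rewrite PQ.
  by case: eqP => [->|/eqP ji]; rewrite ?QP ?QP0.
- have ZE : \sum_i Z *m P i = Z by rewrite -mulmx_sumr P1 mulmx1.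
  rewrite -[in LHS]ZE -[RHS]ZE mulmx_suml; apply: eq_bigr => i _; have [_ _ ZQ _] := HQ i.
  rewrite mulmx_sumr (bigD1 i) //= ZQ big1 ?addr0 // => j ji.
  by rewrite -mulmxA PQ (negbTE ji) mulmx0.
- rewrite raddf_sum /= (eq_bigr (fun i => (\rank (Z *m P i))%:R)); last first.
    by move=> i _; have [] := HQ i.
  by rewrite -natr_sum ler_nat -sum_nat_const leq_sum // => i _; exact: rank_leq_row.
Qed.


(** * Tensor products and matrix units *)

Lemma tensmx_suml m n p q (I : finType) (F : I -> 'M[C]_(m, n)) (B : 'M[C]_(p, q)) :
  (\sum_i F i) *t B = \sum_i F i *t B.
Proof.
apply/matrixP => i j; rewrite summxE !mxE summxE mulr_suml.
by apply: eq_bigr => k _; rewrite mxE.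
Qed.

Lemma tensmx_sumr m n p q (I : finType) (A : 'M[C]_(m, n)) (F : I -> 'M[C]_(p, q)) :
  A *t (\sum_i F i) = \sum_i A *t F i.
Proof.
apply/matrixP => i j; rewrite summxE !mxE summxE mulr_sumr.
by apply: eq_bigr => k _; rewrite mxE.
Qed.

Lemma tensmxZl m n p q a (A : 'M[C]_(m, n)) (B : 'M[C]_(p, q)) :
  (a *: A) *t B = a *: (A *t B).
Proof. by apply/matrixP => i j; rewrite !mxE mulrA. Qed.

Lemma tensmx11 m n : 1%:M *t 1%:M = 1%:M :> 'M[C]_(m * n).
Proof.
apply/matrixP => i j; case: (mxtens_indexP i) => a x; case: (mxtens_indexP j) => b y.
rewrite tensmxE !mxE -natrM mulnb (can_eq (@mxtens_indexK _ _)).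
by rewrite xpair_eqE.
Qed.

Lemma sum_delta_mx n : \sum_a delta_mx a a = 1%:M :> 'M[C]_n.
Proof.
by rewrite -diag_const_mx diag_mx_sum_delta; apply: eq_bigr => a _; rewrite mxE scale1r.
Qed.

Lemma mul_delta_mx_mul n (A : 'M[C]_n) a b :
  delta_mx a a *m A *m delta_mx b b = A a b *: delta_mx a b.
Proof.
apply/matrixP => i j; rewrite mxE (bigD1 b) //= big1 => [|k kb]; last first.
  by rewrite [delta_mx b b k j]mxE (negbTE kb) mulr0.
rewrite !mxE eqxx (bigD1 a) //= big1 => [|k ka]; last first.
  by rewrite mxE (negbTE ka) andbF mul0r.
rewrite mxE eqxx !addr0 andbT; case: eqP => _; case: eqP => _ //=;
by rewrite ?(mulr0, mul0r, mulr1, mul1r).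
Qed.

(** * Pinching by the color projectors *)

Section Pinching.
Variables (n d : nat) (I : finType) (E : 'I_n -> I -> 'M[C]_d).
Hypothesis Ep : forall a i, mxprojector (E a i).
Hypothesis E1 : forall a, \sum_i E a i = 1%:M.

Definition color_projector (i : I) : 'M[C]_(n * d) := \sum_a delta_mx a a *t E a i.

Lemma color_projectorP i : mxprojector (color_projector i).
Proof.
apply: mxprojector_sum => [a|a b ab].
- have [EE Eh] := Ep a i; split; first by rewrite tensmx_mul mul_delta_mx EE.
  by rewrite trCmx_tens Eh trmx_delta map_delta_mx.
- by rewrite tensmx_mul mul_delta_mx_0 // tens0mx.
Qed.

Lemma color_projector_sum1 : \sum_i color_projector i = 1%:M.
Proof.
rewrite exchange_big /= (eq_bigr (fun a => delta_mx a a *t 1%:M)) => [|a _].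
  by rewrite -tensmx_suml sum_delta_mx tensmx11.
by rewrite -tensmx_sumr E1.
Qed.

(** The block at [(a, b)] of the [i]-th summand is [B a b *: (E a i *m E b i)]. Off the diagonal one
    of the two factors vanishes; on the diagonal the projectors [E a i] add up to the identity over
    [i]. *)
Lemma pinchingE (B : 'M[C]_n) :
  (forall a b i, a != b -> B a b != 0 -> E a i *m E b i = 0) ->
  \sum_i color_projector i *m (B *t 1%:M) *m color_projector i =
  \sum_a B a a *: (delta_mx a a *t 1%:M).
Proof.
move=> BE.
transitivity (\sum_i \sum_a B a a *: (delta_mx a a *t E a i)).
  apply: eq_bigr => i _; rewrite !mulmx_suml; apply: eq_bigr => a _.
  rewrite mulmx_sumr (bigD1 a) //= big1 => [|b ba]; last first.
    rewrite !tensmx_mul mulmx1 mul_delta_mx_mul tensmxZl.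
    have [->|Bab] := eqVneq (B a b) 0; first by rewrite scale0r.
    by rewrite BE ?tensmx0 ?scaler0 // eq_sym.
  have [EE _] := Ep a i.
  by rewrite !tensmx_mul mulmx1 mul_delta_mx_mul tensmxZl EE addr0.
rewrite exchange_big; apply: eq_bigr => a _.
by rewrite -scaler_sumr -tensmx_sumr E1.
Qed.

Lemma mxtrace_pinching_le (B : 'M[C]_n) (w : C) (Q : 'M[C]_(n * d)) :
    (forall a b i, a != b -> B a b != 0 -> E a i *m E b i = 0) ->
    (forall a, B a a <= w) -> mxprojector Q ->
    (forall i, Q *m color_projector i = color_projector i *m Q) ->
  \tr (Q *m (B *t 1%:M)) <= w * \tr Q.
Proof.
move=> BE Bw Qp QP.
have -> : \tr (Q *m (B *t 1%:M)) = \sum_a B a a * \tr (Q *m (delta_mx a a *t 1%:M)).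
  have -> : \sum_a B a a * \tr (Q *m (delta_mx a a *t 1%:M)) =
            \tr (Q *m \sum_a B a a *: (delta_mx a a *t 1%:M)).
    rewrite mulmx_sumr raddf_sum; apply: eq_bigr => a _.
    by rewrite -scalemxAr /= mxtraceZ.
  (* Insert the sum of the color projectors and write each as its own square; one copy goes around
     the trace and through [Q], with which it commutes. *)
  rewrite -pinchingE // -[in LHS](mulmx1 (B *t _)) -color_projector_sum1.
  rewrite !mulmx_sumr !raddf_sum; apply: eq_bigr => i _ /=.
  have [PP _] := color_projectorP i.
  rewrite -[in LHS]PP !mulmxA [LHS]mxtrace_mulC !mulmxA.
  by rewrite -QP.
have QE : \tr Q = \sum_a \tr (Q *m (delta_mx a a *t 1%:M)).
  by rewrite -raddf_sum -mulmx_sumr -tensmx_suml sum_delta_mx tensmx11 mulmx1.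
rewrite QE mulr_sumr ler_sum // => a _; apply: ler_wpM2r => //.
(* In the form [Y^t* *m Y] the block projector falls under [mxtrace_projector_ge0]. *)
have -> : delta_mx a a *t 1%:M = (delta_mx (0 : 'I_1) a *t 1%:M)^t* *m
    (delta_mx (0 : 'I_1) a *t 1%:M) :> 'M[C]_(n * d).
  rewrite trCmx_tens trmx_delta map_delta_mx trmx1 map_mx1 tensmx_mul mulmx1.
  by rewrite mul_delta_mx.
exact: mxtrace_projector_ge0.
Qed.

(** [t j] is the trace of [Q] against the projector onto [row j U] tensored with all of [C^d], not
    yet divided by [d]. The index [j0] selects the eigenvector that [Q] is built to fix. *)
Lemma spectral_weights (B U : 'M[C]_n) (mu : 'rV[C]_n) (w : C) (j0 : 'I_n) :
    U \is unitarymx -> B = U^t* *m diag_mx mu *m U ->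
    (forall a b i, a != b -> B a b != 0 -> E a i *m E b i = 0) ->
    (forall a, B a a <= w) ->
  exists t : 'I_n -> C, [/\ forall j, 0 <= t j <= d%:R, t j0 = d%:R,
    \sum_j t j <= (#|I| * d)%:R & \sum_j mu 0 j * t j <= w * \sum_j t j].
Proof.
move=> Uu BU BE Bw; have UU := unitarymxP Uu.
have UU' : U^t* *m U = 1%:M by exact: mulmx1C.
pose Y j : 'M[C]_(1 * d, n * d) := row j U *t 1%:M.
have YE j : (Y j)^t* *m Y j = (U^t* *m delta_mx j j *m U) *t 1%:M.
  rewrite trCmx_tens trmx1 map_mx1 tensmx_mul mulmx1; congr (_ *t _).
  rewrite rowE trCmx_mul trmx_delta map_delta_mx -!mulmxA; congr (_ *m _).
  by rewrite mulmxA mul_delta_mx.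
have YY j : \tr ((Y j)^t* *m Y j) = d%:R.
  rewrite mxtrace_mulC trCmx_tens trmx1 map_mx1 tensmx_mul mulmx1.
  rewrite rowE trCmx_mul mulmxA -(mulmxA _ U) UU mulmx1.
  rewrite trmx_delta map_delta_mx mul_delta_mx.
  have -> : delta_mx 0 0 = 1%:M :> 'M[C]_1.
    by apply/matrixP => x y; rewrite !mxE !ord1.
  by rewrite tensmx11 mxtrace1 mul1n.
have [Q [Qp QP YQ trQ]] :=
  block_projector (Y j0) color_projectorP color_projector_sum1.
exists (fun j => \tr (Q *m ((Y j)^t* *m Y j))); rewrite -raddf_sum -mulmx_sumr.
have -> : \sum_j (Y j)^t* *m Y j = 1%:M.
  rewrite (eq_bigr _ (fun j _ => YE j)) -tensmx_suml -mulmx_suml -mulmx_sumr.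
  by rewrite sum_delta_mx mulmx1 UU' tensmx11.
rewrite mulmx1; split.
(* The upper bound is positivity for the complementary projector [1%:M - Q]. *)
- move=> j; rewrite mxtrace_projector_ge0 //= -(YY j) -subr_ge0 -raddfB /=.
  rewrite -[X in X - _]mul1mx -mulmxBl; apply: mxtrace_projector_ge0.
  exact: mxprojector_compl.
- have [_ Qh] := Qp; rewrite mulmxA -{1}Qh -trCmx_mul YQ; exact: YY.
- by rewrite -[in X in _ <= X](mul1n d).
- rewrite (eq_bigr (fun j => \tr (Q *m (mu 0 j *: ((Y j)^t* *m Y j))))); last first.
    by move=> j _; rewrite -scalemxAr mxtraceZ.
  rewrite -raddf_sum -mulmx_sumr.
  have -> : \sum_j mu 0 j *: ((Y j)^t* *m Y j) = B *t 1%:M.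
    rewrite BU diag_mx_sum_delta mulmx_sumr mulmx_suml tensmx_suml.
    apply: eq_bigr => j _; rewrite YE -tensmxZl; congr (_ *t _).
    by rewrite -scalemxAr -scalemxAl.
  exact: mxtrace_pinching_le.
Qed.

End Pinching.

End ConjugateTranspose.

(** * Eigenvalues of real symmetric matrices *)

Section Reals.
Variable R : realType.

Lemma sum_smallest_le (n m : nat) (mu s : 'I_n -> R) (L : seq R) :
    perm_eq L [seq mu j | j <- enum 'I_n] -> sorted >=%R L ->
    (forall j, 0 <= s j <= 1) -> \sum_j s j = m%:R ->
  \sum_(1 <= i < m.+1) L`_(n - i) <= \sum_j mu j * s j.
Proof.
move=> Lmu Ls s01 sm.
have sL : size L = n by rewrite (perm_size Lmu) size_map size_enum_ord.
(* For [m = 0] the threshold [th] below would be the default value past the end of [L]. *)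
have [m0|m_gt0] := posnP m.
  rewrite m0 big_geq // big1 // => j _.
  rewrite (psumr_eq0P _ (_ : \sum_j s j = 0)) ?mulr0 ?sm ?m0 // => k _.
  by have /andP[] := s01 k.
have mn : (m <= n)%N.
  rewrite -(ler_nat R) -sm -[leRHS]mulr1 -[n in leRHS]card_ord -sum1_card natr_sum mulr_suml.
  by apply: ler_sum => j _; rewrite mul1r; have /andP[] := s01 j.
(* Compare each [mu j] with the threshold [th], the m-th smallest value:
   [(mu j - th) * s j >= min (mu j - th, 0)]. *)
set th := L`_(n - m).
have -> : \sum_j mu j * s j = th * m%:R + \sum_j (mu j - th) * s j.
  by rewrite -sm mulr_sumr -big_split; apply: eq_bigr => j _ /=; rewrite -mulrDl addrC subrK.
have H1 : \sum_j Num.min (mu j - th) 0 <= \sum_j (mu j - th) * s j.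
  apply: ler_sum => j _; have /andP[s0 s1] := s01 j.
  by case: (leP (mu j - th) 0) => h; nra.
apply: le_trans (lerD (lexx _) H1).
have -> : \sum_j Num.min (mu j - th) 0 = \sum_(x <- L) Num.min (x - th) 0.
  by rewrite (perm_big _ Lmu) big_map big_enum.
rewrite [X in _ + X](big_nth 0) sL [X in _ + X](big_cat_nat (n := n - m)) ?leq_subr //=.
(* As [L] is nonincreasing, the entries before index [n - m] are at least [th] and have minimum 0;
   the last [m] are at most [th] and contribute their full difference. *)
have H2 : 0 <= \sum_(0 <= i < n - m) Num.min (L`_i - th) 0.
  rewrite big_seq sumr_ge0 // => i; rewrite mem_index_iota => /andP[_ im].
  rewrite le_min lexx andbT subr_ge0.
  have := sorted_ltn_nth (@ge_trans _ R) 0 Ls.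
  by apply; rewrite ?inE ?sL // ?(leq_trans im) ?leq_subr // ltn_subrL m_gt0 (leq_trans m_gt0).
have H3 : \sum_(n - m <= i < n) (L`_i - th) <= \sum_(n - m <= i < n) Num.min (L`_i - th) 0.
  rewrite big_seq [leRHS]big_seq; apply: ler_sum => i; rewrite mem_index_iota => /andP[mi i_n].
  rewrite le_min lexx /= subr_le0.
  have := sorted_leq_nth (@ge_trans _ R) (@lexx _ R) 0 Ls.
  by apply; rewrite ?inE ?sL // (leq_ltn_trans mi).
have H4 : \sum_(n - m <= i < n) (L`_i - th) = \sum_(1 <= i < m.+1) L`_(n - i) - th * m%:R.
  rewrite sumrB; congr (_ - _); last by rewrite sumr_const_nat subKn // mulr_natr.
  rewrite big_add1 /= -{1}[(n - m)%N]add0n big_addn subKn // big_nat_rev /=.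
  apply: eq_big_nat => i /andP[_ im].
  by rewrite add0n addnC addnBA // subnK.
lra.
Qed.

(** Both lists contain each [y] as often as its multiplicity as a root of the characteristic
    polynomial: [rootsR] lists every real root once, so at most one block of copies counts. *)
Lemma eigenvalues_perm (n : nat) (B : 'M[R]_n) (s : seq R) :
  char_poly B = \prod_(x <- s) ('X - x%:P) -> perm_eq (eigenvalues B) s.
Proof.
move=> Bs; rewrite /eigenvalues perm_sort; apply/allP => y _ /=; apply/eqP.
have p0 : char_poly B != 0 by rewrite monic_neq0 ?char_poly_monic.
have ur : uniq (rootsR (char_poly B)) by exact: uniq_roots.
have ry : (y \in rootsR (char_poly B)) = root (char_poly B) y.
  by have := roots_on_rootsR p0 y; rewrite inE.
rewrite count_flatten -map_comp -[RHS]mu_prod_XsubC -Bs.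
transitivity (\sum_(x <- rootsR (char_poly B)) if x == y then mup x (char_poly B) else 0)%N.
  rewrite sumnE big_map; apply: eq_bigr => x _ /=; rewrite count_nseq /=.
  by case: eqP => _; rewrite ?mul1n ?mul0n.
rewrite -big_mkcond /=.
have [yr|yr] := boolP (y \in rootsR (char_poly B)).
  by rewrite (big_rem y) //= eqxx big_seq_cond big1 ?addn0 // => x /andP[];
     rewrite mem_rem_uniq // inE => /andP[/negbTE ->].
rewrite mupNroot -?ry // big_seq_cond big1 // => x /andP[xr /eqP xy].
by rewrite -xy xr in yr.
Qed.

Lemma char_poly_diag_conj (F : comNzRingType) (n : nat) (U V : 'M[F]_n) (mu : 'rV[F]_n) :
  V *m U = 1%:M -> char_poly (V *m diag_mx mu *m U) = \prod_j ('X - (mu 0 j)%:P).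
Proof.
move=> VU; rewrite /char_poly /char_poly_mx.
have VUp : map_mx polyC V *m map_mx polyC U = 1%:M by rewrite -map_mxM VU map_mx1.
have -> : 'X%:M - map_mx polyC (V *m diag_mx mu *m U) =
  map_mx polyC V *m ('X%:M - map_mx polyC (diag_mx mu)) *m map_mx polyC U.
  by rewrite mulmxBr mulmxBl !map_mxM scalar_mxC -(mulmxA 'X%:M) VUp mulmx1.
rewrite !det_mulmx mulrAC -det_mulmx VUp det1 mul1r.
rewrite -[LHS]/(char_poly (diag_mx mu)) char_poly_trig ?diag_mx_is_trig //.
by apply: eq_bigr => j _; rewrite mxE eqxx.
Qed.

Local Notation toC := (real_complex R).

(** Over the complex numbers the matrix is Hermitian, so it is unitarily diagonalizable with real
    diagonal, and taking real parts of the diagonal loses nothing. *)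
Lemma real_symmetric_spectral (n : nat) (A : 'M[R]_n) : A^T = A ->
  exists (U : 'M[R[i]]_n) (a : 'rV[R]_n),
    U \is unitarymx /\ map_mx toC A = U^t* *m diag_mx (map_mx toC a) *m U.
Proof.
move=> As.
have Ah : map_mx toC A \is hermsymmx.
  apply: realsym_hermsym.
    apply/is_hermitianmxP; rewrite expr0 scale1r; apply/matrixP => i j.
    by rewrite -{1}As !mxE.
  apply/mxOverP => i j; rewrite mxE; apply/complex_realP; by eexists.
have Ar := hermitian_spectral_diag_real Ah.
have /orthomx_spectralP AE := hermitian_normalmx Ah.
have Uu := spectral_unitarymx (map_mx toC A).
exists (spectralmx (map_mx toC A)), (map_mx (@complex.Re R) (spectral_diag (map_mx toC A))).
split => //; rewrite -invmx_unitary // {1}AE; congr (_ *m diag_mx _ *m _).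
apply/matrixP => i j; rewrite !mxE RRe_real //; exact: (mxOverP Ar).
Qed.

(** Keeping the same [U] pairs each eigenvalue of [A] with its image under [p], a link that the
    sorted lists of eigenvalues do not record. *)
Lemma mxpoly_spectral (n : nat) (A : 'M[R]_n) (U : 'M[R[i]]_n) (a : 'rV[R]_n) (p : {poly R}) :
    U \is unitarymx -> map_mx toC A = U^t* *m diag_mx (map_mx toC a) *m U ->
  map_mx toC (mxpoly p A) = U^t* *m diag_mx (map_mx toC (map_mx (horner p) a)) *m U.
Proof.
move=> Uu AE; have UU := unitarymxP Uu; have UU' := mulmx1C UU.
have Ai i : map_mx toC (A ^+ i) = U^t* *m diag_mx (map_mx toC (map_mx (fun x => x ^+ i) a)) *m U.
  elim: i => [|i IH].
    rewrite expr0 map_mx1.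
    have -> : map_mx toC (map_mx (fun x => x ^+ 0) a) = const_mx 1.
      by apply/matrixP => x y; rewrite !mxE expr0.
    by rewrite diag_const_mx mulmx1 UU'.
  rewrite exprS map_mxM /= IH AE !mulmxA -(mulmxA _ U) UU mulmx1.
  rewrite -(mulmxA (U^t*) (diag_mx _)) mulmx_diag; congr (_ *m diag_mx _ *m _).
  by apply/matrixP => x y; rewrite !mxE (ord1 x) exprS rmorphM.
rewrite /mxpoly (raddf_sum (map_mx toC)) /=.
rewrite (eq_bigr (fun i : 'I__ => U^t* *m diag_mx (toC p`_i *: map_mx toC (map_mx (fun x => x ^+ i) a)) *m U)); last first.
  by move=> i _; rewrite map_mxZ Ai linearZ /= -scalemxAr -scalemxAl.
rewrite -mulmx_suml -mulmx_sumr -raddf_sum; congr (_ *m diag_mx _ *m _).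
apply/matrixP => x y; rewrite summxE !mxE horner_coef rmorph_sum.
by apply: eq_bigr => i _; rewrite !mxE -rmorphM.
Qed.

(** The characteristic polynomials are compared over the complex numbers; injectivity of the
    coefficient embedding brings the equality back to [R]. *)
Lemma eigenvalues_spectral (n : nat) (B : 'M[R]_n) (U : 'M[R[i]]_n) (b : 'rV[R]_n) :
    U \is unitarymx -> map_mx toC B = U^t* *m diag_mx (map_mx toC b) *m U ->
  perm_eq (eigenvalues B) [seq b 0 j | j <- enum 'I_n].
Proof.
move=> Uu BE; apply: eigenvalues_perm; rewrite big_map big_enum /=.
apply: (map_poly_inj toC); rewrite map_char_poly BE char_poly_diag_conj; last first.
  exact/mulmx1C/unitarymxP.
rewrite rmorph_prod; apply: eq_bigr => j _.
by rewrite rmorphB /= map_polyX map_polyC mxE.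
Qed.

End Reals.

(** * Walks, distance and the entries of [p(A)] *)

Section Graph.
Variables (R : realType) (V : finType) (e : rel V).

Lemma adjmx_sym : symmetric e -> (adjmx R e)^T = adjmx R e.
Proof. by move=> es; apply/matrixP => a b; rewrite !mxE es. Qed.

(** A nonzero entry of a product has a nonzero summand, which supplies the first edge of the
    walk. *)
Lemma adjmx_exp_walk m a b : (adjmx R e ^+ m) a b != 0 ->
  exists s : seq V, [/\ size s = m, path e (enum_val a) s
                      & last (enum_val a) s = enum_val b].
Proof.
elim: m a => [|m IH] a.
  rewrite expr0 mxE; case: (a =P b) => [<- _|_]; last by rewrite eqxx.
  by exists [::].
rewrite exprS mxE => /eqP H.
have [x Hx] : exists x, adjmx R e a x * (adjmx R e ^+ m) x b != 0.
  apply/existsP; rewrite -negb_forall; apply/negP => /forallP H0.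
  by apply: H; apply: big1 => x _; apply/eqP.
move: Hx; rewrite mulf_eq0 negb_or => /andP[ax /IH[s [ss es ls]]].
move: ax; rewrite mxE; case eax: (e _ _); last by rewrite eqxx.
by move=> _; exists (enum_val x :: s); rewrite /= ss eax.
Qed.

(** A walk shorter than [#|V|] stops the search in [gdist] at its own length or earlier; for a
    longer one, the search never returns more than [#|V|]. *)
Lemma walk_within_dist k v s :
  path e v s -> (size s <= k)%N -> within_dist e k v (last v s).
Proof.
move=> es sk; rewrite /within_dist; apply/andP; split; first by apply/connectP; exists s.
apply: leq_trans sk; rewrite /gdist; set q := (X in find X _).
have [sV|Vs] := ltnP (size s) #|V|; last first.
  by rewrite (leq_trans (find_size _ _)) // size_iota.
rewrite leqNgt; apply/negP => /(before_find 0%N).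
rewrite nth_iota // add0n => /negbT/negP; apply.
by rewrite /q /=; apply/existsP; exists (in_tuple s); rewrite /= es eqxx.
Qed.

(** Here the degree bound on [p] meets the coloring: wherever an off-diagonal entry of [p(A)] is
    nonzero, distance-[k] orthogonality applies. *)
Lemma mxpoly_adjmx_within_dist k (p : {poly R}) a b : (size p <= k.+1)%N ->
  mxpoly p (adjmx R e) a b != 0 -> within_dist e k (enum_val a) (enum_val b).
Proof.
move=> pk; rewrite /mxpoly summxE => H.
have [i Hi] : exists i : 'I_(size p), (p`_i *: adjmx R e ^+ i) a b != 0.
  apply/existsP; rewrite -negb_forall; apply/negP => /forallP H0.
  by move/eqP: H; apply; apply: big1 => x _; apply/eqP.
move: Hi; rewrite mxE mulf_eq0 negb_or => /andP[_ /adjmx_exp_walk[s [ss es <-]]].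
by apply: walk_within_dist => //; rewrite ss -ltnS (leq_trans (ltn_ord i)).
Qed.

Lemma diag_le_W (p : {poly R}) u : mxpoly p (adjmx R e) u u <= W e p.
Proof.
rewrite /W; set M := (X in fine X).
have le_max : ((mxpoly p (adjmx R e) u u)%:E <= M)%E.
  exact: (le_bigmax _ (fun v => (mxpoly p (adjmx R e) v v)%:E) u).
(* The maximum is finite, so [fine] keeps its value: the entry at [u] holds it above [-oo], and
   every entry is below [+oo]. *)
rewrite -lee_fin fineK // fin_numElt (lt_le_trans _ le_max) ?ltNyr //=.
by apply/bigmax_ltP; split=> // v _; exact: ltry.
Qed.

End Graph.

(** * Normalized weights of prescribed sum, and the bound on colors *)

Section Weights.
Variable R : realType.
Local Notation toC := (real_complex R).

(** Move [s] towards the constant weight 1 until the sum is [c]. The bound by [w] is linear in the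
    weights and holds at both ends, hence in between; [c <= n%:R] keeps the mixing coefficient at
    most 1. *)
Lemma weights_raise (n : nat) (mu s : 'I_n -> R) (c w : R) :
    (forall j, 0 <= s j <= 1) -> \sum_j s j <= c -> c <= n%:R ->
    \sum_j mu j * s j <= w * \sum_j s j -> \sum_j mu j <= w * n%:R ->
  exists s' : 'I_n -> R, [/\ forall j, s j <= s' j <= 1,
    \sum_j s' j = c & \sum_j mu j * s' j <= w * c].
Proof.
move=> s01; set r := \sum_j s j => rc cn mus mun.
(* If [n = r] then [al = 0], the junk value of the division, and [c = r]. *)
pose al := (c - r) / (n%:R - r).
have al01 : 0 <= al <= 1.
  have [rn|rn] := eqVneq (n%:R - r) 0; first by rewrite /al rn invr0 mulr0 lexx ler01.
  have nr : 0 < n%:R - r by rewrite lt0r rn subr_ge0 (le_trans rc).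
  by rewrite /al divr_ge0 ?subr_ge0 ?ler_pdivrMr ?mul1r ?lerD2r // (le_trans rc).
have alE : al * (n%:R - r) = c - r.
  have [rn|rn] := eqVneq (n%:R - r) 0; last by rewrite divfK.
  by rewrite rn mulr0; lra.
have sum1 : \sum_(j < n) 1 = n%:R :> R by rewrite sumr_const card_ord.
exists (fun j => s j + al * (1 - s j)); split.
- by move=> j; have /andP[] := s01 j; move: al01 => /andP[*]; apply/andP; split; nra.
- by rewrite big_split -mulr_sumr sumrB /= sum1 -/r alE addrC subrK.
- have -> : \sum_j mu j * (s j + al * (1 - s j)) =
            (1 - al) * (\sum_j mu j * s j) + al * \sum_j mu j.
    by rewrite !mulr_sumr -big_split; apply: eq_bigr => j _ /=; ring.
  move: al01 => /andP[? ?]; have -> : c = r + al * (n%:R - r) by rewrite alE addrC subrK.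
  have ? := ler_wpM2l (_ : 0 <= 1 - al) mus; have ? := ler_wpM2l (_ : 0 <= al) mun.
  nra.
Qed.

Lemma real_spectral_weights (n d c : nat) (E : 'I_n -> 'I_c -> 'M[R[i]]_d)
    (B : 'M[R]_n) (U : 'M[R[i]]_n) (mu : 'rV[R]_n) (w : R) (j0 : 'I_n) :
    (0 < d)%N -> (c <= n)%N ->
    (forall a i, mxprojector (E a i)) -> (forall a, \sum_i E a i = 1%:M) ->
    U \is unitarymx -> map_mx toC B = U^t* *m diag_mx (map_mx toC mu) *m U ->
    (forall a b i, a != b -> B a b != 0 -> E a i *m E b i = 0) ->
    (forall a, B a a <= w) ->
  exists s : 'I_n -> R, [/\ forall j, 0 <= s j <= 1, s j0 = 1,
    \sum_j s j = c%:R & \sum_j mu 0 j * s j <= w * c%:R].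
Proof.
move=> d0 cn Ep E1 Uu BE BEE Bw.
have [|a|t [t01 t1 tc mut]] := spectral_weights (w := toC w) Ep E1 j0 Uu BE.
- by move=> a b i ab; rewrite mxE fmorph_eq0; exact: BEE.
- by rewrite mxE lecR.
have dC : (d%:R : R[i]) = toC d%:R by rewrite rmorph_nat.
have dR : 0 < d%:R :> R by rewrite ltr0n.
pose r j := complex.Re (t j).
(* Nonnegative elements of [R[i]] are real. *)
have tr j : t j = toC (r j).
  by rewrite [RHS]RRe_real // ger0_real //; have /andP[] := t01 j.
have r01 j : 0 <= r j <= d%:R.
  by have := t01 j; rewrite tr dC -(rmorph0 toC) !lecR.
have sumt : \sum_j t j = toC (\sum_j r j).
  by rewrite rmorph_sum; apply: eq_bigr => j _.
have rc : \sum_j r j <= c%:R * d%:R.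
  by rewrite -natrM -lecR -sumt rmorph_nat -[c in X in _ <= X]card_ord.
have mur : \sum_j mu 0 j * r j <= w * \sum_j r j.
  rewrite -lecR rmorphM /= -sumt; apply: le_trans mut; rewrite rmorph_sum le_eqVlt.
  by apply/orP; left; apply/eqP; apply: eq_bigr => j _; rewrite tr mxE rmorphM.
(* The bound for the constant weight 1 comes from the trace of [B]. *)
have trB : \sum_j mu 0 j <= w * n%:R.
  have -> : \sum_j mu 0 j = \tr B.
    apply: (@complexI R); rewrite -[RHS]trace_map_mx BE mxtrace_mulC mulmxA.
    rewrite (unitarymxP Uu) mul1mx mxtrace_diag rmorph_sum.
    by apply: eq_bigr => j _; rewrite mxE.
  rewrite mulr_natr -[n in X in _ <= X]card_ord -sumr_const.
  exact: ler_sum.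
have sE : \sum_j r j / d%:R = (\sum_j r j) / d%:R by rewrite mulr_suml.
have [||||s [rs sc mus]] := weights_raise (mu := mu 0) (s := fun j => r j / d%:R)
  (c := c%:R) (w := w) _ _ _ _ trB.
- move=> j; have /andP[r0 r1] := r01 j.
  by rewrite divr_ge0 ?ler_pdivrMr ?mul1r // ltW.
- by rewrite sE ler_pdivrMr.
- by rewrite ler_nat.
- rewrite sE mulrA; under eq_bigr do rewrite mulrA; rewrite -mulr_suml.
  by rewrite ler_pM2r ?invr_gt0.
exists s; split=> // [j|].
- have /andP[rsj ->] := rs j; rewrite andbT; apply: le_trans rsj.
  by have /andP[r0 _] := r01 j; rewrite divr_ge0 // ltW.
(* A weight that is already 1 is squeezed between 1 and 1 when raised. *)
- apply/le_anti; have /andP[rsj ->] := rs j0; apply: le_trans rsj.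
  suff -> : r j0 = d%:R by rewrite divff // gt_eqF.
  by apply: (@complexI R); rewrite -tr t1 dC.
Qed.

End Weights.

(** The unit weight at [j0] accounts for [p(lambda_1)]; the remaining weights sum to [c.-1] and
    dominate the [c.-1] smallest eigenvalues of [p(A)]. *)
Lemma kappa_ineq_colorable (R : realType) (V : finType) (e : rel V) (k c : nat)
    (p : {poly R}) :
    symmetric e -> (0 < #|V|)%N -> (size p <= k.+1)%N ->
    (0 < c <= #|V|)%N -> quantum_colorable R e k c ->
  kappa_ineq e p c.-1.
Proof.
move=> es V0 pk /andP[c0 cV] [d d0 [P [Pp P1 Pe]]].
have [U [a [Uu AE]]] := real_symmetric_spectral (adjmx_sym R es).
have BE := mxpoly_spectral p Uu AE.
set b := map_mx _ a in BE; set B := mxpoly p _ in BE.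
(* The diagonal [a] comes in no particular order, so the position of the largest eigenvalue must be
   located. *)
have [j0 aj0] : exists j0, lambda (adjmx R e) 1 = a 0 j0.
  have ea := eigenvalues_spectral Uu AE.
  have : lambda (adjmx R e) 1 \in eigenvalues (adjmx R e).
    by rewrite /lambda mem_nth // (perm_size ea) size_map size_enum_ord.
  by rewrite (perm_mem ea) => /mapP[j _ ->]; exists j.
have [a' i|a'|x y i xy Bxy|x|s [s01 s1 sc bs]] :=
  real_spectral_weights (E := fun a i => P (enum_val a) i) (w := W e p) j0 d0 cV _ _ Uu BE.
- exact: Pp.
- exact: P1.
- apply: Pe; first by rewrite (inj_eq enum_val_inj).
  exact: mxpoly_adjmx_within_dist Bxy.
- exact: diag_le_W.
rewrite /kappa_ineq prednK // mulrC; apply: le_trans bs.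
(* Zeroing the weight at [j0], rather than deleting the index, keeps the comparison over all
   eigenvalues of [p(A)], as in [kappa_ineq]. *)
pose s' j := if j == j0 then 0 else s j.
rewrite (bigD1 j0) //= s1 mulr1 aj0 mxE lerD2l.
have -> : \sum_(j | j != j0) b 0 j * s j = \sum_j b 0 j * s' j.
  rewrite [RHS](bigD1 j0) //= /s' eqxx mulr0 add0r.
  by apply: eq_bigr => j /negbTE ->.
have s'c : \sum_j s' j = c.-1%:R.
  rewrite (bigD1 j0) //= /s' eqxx add0r.
  have := sc; rewrite (bigD1 j0) //= s1 -{1}(prednK c0) -natr1 addrC => /addIr <-.
  by apply: eq_bigr => j /negbTE ->.
have le_s' := sum_smallest_le (eigenvalues_spectral Uu BE) _ _ s'c.
rewrite prednK // in le_s'.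
rewrite (eq_bigr (fun i => (eigenvalues B)`_(#|V| - i))) => [|i _]; last first.
  by rewrite /lambda addn1.
apply: le_s'; first exact: sort_sorted ge_total _.
by move=> j; rewrite /s'; case: (j == j0); rewrite ?lexx ?ler01.
Qed.

Theorem mainTheorem2 (R : realType) (V : finType) (e : rel V) (k : nat)
    (p : {poly R})
    (e_sym : symmetric e) (e_irr : irreflexive e)
    (e_conn : connected_graph e)
    (k_gt0 : (0 < k)%N)
    (p_deg : (size p <= k.+1)%N)
    (p_max : (Lambda e p <= (p.[lambda (adjmx R e) 1])%:E)%E) :
  (kappa e p + 1 <= quantum_chromatic R e k)%N.
Proof.
have [V0 _] := e_conn; rewrite /quantum_chromatic.
case: ex_minnP => c /asboolP col _; rewrite addn1.
(* With no colors the empty sum would be the identity in positive dimension. *)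
have c0 : (0 < c)%N.
  case: col => d d0 [P [_ P1 _]]; have /card_gt0P[v _] := V0.
  case: c => // in P P1 *; have := P1 v; rewrite big_ord0 => /esym/eqP.
  by case: d d0 P P1 => // d _ P P1; rewrite oner_eq0.
(* Beyond [#|V|] colors the bound is immediate, since the search defining [kappa] returns at most
   [#|V|]. *)
have [cV|Vc] := leqP c #|V|; last first.
  by apply: leq_ltn_trans Vc; rewrite -[leqRHS](size_iota 0); exact: find_size.
(* If [kappa] exceeded [c.-1], the inequality would fail at the index [c.-1], which lies in the
   searched range. *)
rewrite -(prednK c0) ltnS /kappa leqNgt; apply/negP => /(before_find 0%N).
rewrite nth_iota ?prednK // add0n => /negbT/negP; apply.
by apply: kappa_ineq_colorable col => //; rewrite c0.
Qed.
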